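(* The function $$S^{-1}(s,q)=-(q^2-2q\,\mathrm{Re}(s)+|s|^2)^{-1}(q-\overline{s})$$ is left (slice) regular in the variable $q$ and right (slice) regular in the variable $s$ in its domain of definition; that is, for each fixed $s\in\mathbb{H}$ the function $q\mapsto S^{-1}(s,q)$ is left regular on $\{q\in\mathbb{H}: q^2-2q\,\mathrm{Re}(s)+|s|^2\ne0\}$, and for each fixed $q\in\mathbb{H}$ the function $s\mapsto S^{-1}(s,q)$ is right regular on $\{s\in\mathbb{H}: q^2-2q\,\mathrm{Re}(s)+|s|^2\neq0\}$.
   Context: $\mathbb{H}$ is the real algebra of quaternions, $\overline s$ the conjugate, $|s|^2=s\overline s$; $\mathbb{S}=\{q\in\mathbb{H}: \mathrm{Re}(q)=0,\ |q|=1\}$. For $I\in\mathbb{S}$, $L_I=\mathbb{R}+I\mathbb{R}$. For an open set $U\subseteq\mathbb{H}$ and $f:U\to\mathbb{H}$, let $f_I$ be the restriction of $f$ to $U\cap L_I$. $f$ is left (slice) regular if for every $I\in\mathbb{S}$, $f_I$ is real differentiable and $\frac12\left(\frac{\partial}{\partial x}f_I(x+yI)+I\frac{\partial}{\partial y}f_I(x+yI)\right)=0$; $f$ is right (slice) regular if for every $I\in\mathbb{S}$, $f_I$ is real differentiable and $\frac12\left(\frac{\partial}{\partial x}f_I(x+yI)+\frac{\partial}{\partial y}f_I(x+yI)\,I\right)=0$. *)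

(* Defs.v *)
From HB Require Import structures.
From mathcomp Require Import all_boot all_order all_algebra ring lra.
From mathcomp Require Import boolp classical_sets reals topology normedtype derive.

Set Implicit Arguments.
Unset Strict Implicit.
Unset Printing Implicit Defensive.

Import Order.TTheory GRing.Theory Num.Theory.
Import numFieldNormedType.Exports.

Local Open Scope classical_set_scope.
Local Open Scope ring_scope.

(* The coordinates are those in the basis 1, i, j, k.  The alias inherits the
   normed space structure of 'rV[R]_4, whose norm `|q| is the sup norm: it has
   the usual topology and notion of differentiability, but it is not the
   quaternionic modulus, which is [qabs] below. *)
Definition quaternion (R : realType) : Type := 'rV[R]_4.

HB.instance Definition _ (R : realType) :=
  NormedModule.copy (quaternion R) 'rV[R]_4.

Definition quat (R : realType) (a b c d : R) : quaternion R :=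
  \row_(i < 4) [:: a; b; c; d]`_i.

Definition qre (R : realType) (q : quaternion R) : R := (q : 'rV[R]_4) 0 0.
Definition qimi (R : realType) (q : quaternion R) : R := (q : 'rV[R]_4) 0 1.
Definition qimj (R : realType) (q : quaternion R) : R := (q : 'rV[R]_4) 0 2.
Definition qimk (R : realType) (q : quaternion R) : R := (q : 'rV[R]_4) 0 3.

Definition qmul (R : realType) (p q : quaternion R) : quaternion R :=
  quat
    (qre p * qre q - qimi p * qimi q - qimj p * qimj q - qimk p * qimk q)
    (qre p * qimi q + qimi p * qre q + qimj p * qimk q - qimk p * qimj q)
    (qre p * qimj q - qimi p * qimk q + qimj p * qre q + qimk p * qimi q)
    (qre p * qimk q + qimi p * qimj q - qimj p * qimi q + qimk p * qre q).

Definition qconj (R : realType) (q : quaternion R) : quaternion R :=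
  quat (qre q) (- qimi q) (- qimj q) (- qimk q).

Definition qinv (R : realType) (q : quaternion R) : quaternion R :=
  (qre (qmul q (qconj q)))^-1 *: qconj q.

Section QuaternionAlgebra.
Variable R : realType.
Implicit Types (a b c d : R) (p q r : quaternion R).

Lemma qre_quat a b c d : qre (quat a b c d) = a.
Proof. by rewrite /qre mxE. Qed.

Lemma qimi_quat a b c d : qimi (quat a b c d) = b.
Proof. by rewrite /qimi mxE. Qed.

Lemma qimj_quat a b c d : qimj (quat a b c d) = c.
Proof. by rewrite /qimj mxE. Qed.

Lemma qimk_quat a b c d : qimk (quat a b c d) = d.
Proof. by rewrite /qimk mxE. Qed.

Definition quatE := (qre_quat, qimi_quat, qimj_quat, qimk_quat).

Lemma quat_eqP p q :
  qre p = qre q -> qimi p = qimi q -> qimj p = qimj q -> qimk p = qimk q ->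
  p = q.
Proof.
move=> h0 h1 h2 h3; apply/rowP => i.
by case: i => -[|[|[|[|//]]]] lti;
  [move: h0 | move: h1 | move: h2 | move: h3];
  rewrite /qre /qimi /qimj /qimk => h;
  (etransitivity; [|etransitivity; [exact: h|]]);
  congr (fun_of_matrix _ _ _); apply: val_inj.
Qed.

Lemma qreD p q : qre (p + q) = qre p + qre q.
Proof. by rewrite /qre mxE. Qed.

Lemma qimiD p q : qimi (p + q) = qimi p + qimi q.
Proof. by rewrite /qimi mxE. Qed.

Lemma qimjD p q : qimj (p + q) = qimj p + qimj q.
Proof. by rewrite /qimj mxE. Qed.

Lemma qimkD p q : qimk (p + q) = qimk p + qimk q.
Proof. by rewrite /qimk mxE. Qed.

Lemma qreZ a q : qre (a *: q) = a * qre q.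
Proof. by rewrite /qre mxE. Qed.

Lemma qimiZ a q : qimi (a *: q) = a * qimi q.
Proof. by rewrite /qimi mxE. Qed.

Lemma qimjZ a q : qimj (a *: q) = a * qimj q.
Proof. by rewrite /qimj mxE. Qed.

Lemma qimkZ a q : qimk (a *: q) = a * qimk q.
Proof. by rewrite /qimk mxE. Qed.

Definition quat_linE := (qreD, qimiD, qimjD, qimkD, qreZ, qimiZ, qimjZ, qimkZ).

Lemma qmulA : associative (@qmul R).
Proof. by move=> p q r; apply: quat_eqP; rewrite /qmul !quatE; ring. Qed.

Lemma qmul1q : left_id (quat 1 0 0 0) (@qmul R).
Proof. by move=> q; apply: quat_eqP; rewrite /qmul !quatE; ring. Qed.

Lemma qmulq1 : right_id (quat 1 0 0 0) (@qmul R).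
Proof. by move=> q; apply: quat_eqP; rewrite /qmul !quatE; ring. Qed.

Lemma qmulDl : left_distributive (@qmul R) +%R.
Proof.
by move=> p q r; apply: quat_eqP; rewrite /qmul !(quat_linE, quatE); ring.
Qed.

Lemma qmulDr : right_distributive (@qmul R) +%R.
Proof.
by move=> p q r; apply: quat_eqP; rewrite /qmul !(quat_linE, quatE); ring.
Qed.

Lemma quat1_neq0 : quat 1 0 0 0 != 0 :> quaternion R.
Proof.
apply/eqP => /(congr1 (@qre R)).
by rewrite qre_quat /qre mxE => /eqP; rewrite oner_eq0.
Qed.

HB.instance Definition _ := GRing.Zmodule_isNzRing.Build (quaternion R)
  qmulA qmul1q qmulq1 qmulDl qmulDr quat1_neq0.

Lemma qscaleAl a p q : a *: (p * q) = (a *: p) * q.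
Proof.
by apply: quat_eqP; rewrite /GRing.mul /= /qmul !(quat_linE, quatE); ring.
Qed.

HB.instance Definition _ :=
  GRing.Lmodule_isLalgebra.Build R (quaternion R) qscaleAl.

Lemma qscaleAr a p q : a *: (p * q) = p * (a *: q).
Proof.
by apply: quat_eqP; rewrite /GRing.mul /= /qmul !(quat_linE, quatE); ring.
Qed.

HB.instance Definition _ :=
  GRing.Lalgebra_isAlgebra.Build R (quaternion R) qscaleAr.

Lemma qre_mul_conj q :
  qre (q * qconj q) =
  qre q ^+ 2 + qimi q ^+ 2 + qimj q ^+ 2 + qimk q ^+ 2.
Proof. by rewrite /GRing.mul /= /qmul /qconj !quatE; ring. Qed.

Lemma qmul_conj q : q * qconj q = (qre (q * qconj q))%:A.
Proof.
rewrite qre_mul_conj; apply: quat_eqP;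
by rewrite /GRing.mul /GRing.one /= /qmul /qconj !(quat_linE, quatE); ring.
Qed.

Lemma qconj_mul q : qconj q * q = (qre (q * qconj q))%:A.
Proof.
rewrite qre_mul_conj; apply: quat_eqP;
by rewrite /GRing.mul /GRing.one /= /qmul /qconj !(quat_linE, quatE); ring.
Qed.

Lemma qre_mul_conj_ge0 q : 0 <= qre (q * qconj q).
Proof. by rewrite qre_mul_conj !addr_ge0 ?sqr_ge0. Qed.

Lemma qre_mul_conj_eq0 q : (qre (q * qconj q) == 0) = (q == 0).
Proof.
apply/eqP/eqP => [|->]; last by rewrite mul0r /qre mxE.
rewrite qre_mul_conj => h; apply: quat_eqP;
  rewrite [RHS]mxE; apply/eqP; rewrite -sqrf_eq0; apply/eqP;
  have := sqr_ge0 (qre q); have := sqr_ge0 (qimi q);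
  have := sqr_ge0 (qimj q); have := sqr_ge0 (qimk q); lra.
Qed.

Lemma qmulVq : {in [pred q : quaternion R | q != 0],
  left_inverse 1 (@qinv R) *%R}.
Proof.
move=> q; rewrite inE -qre_mul_conj_eq0 => q0.
by rewrite /qinv -scalerAl qconj_mul scalerA mulVf // scale1r.
Qed.

Lemma qmulqV : {in [pred q : quaternion R | q != 0],
  right_inverse 1 (@qinv R) *%R}.
Proof.
move=> q; rewrite inE -qre_mul_conj_eq0 => q0.
by rewrite /qinv -scalerAr qmul_conj scalerA mulVf // scale1r.
Qed.

Lemma qunitP p q : q * p = 1 /\ p * q = 1 -> [pred q : quaternion R | q != 0] p.
Proof.
move=> [qp _] /=; apply/eqP => p0.
by move: qp; rewrite p0 mulr0 => /esym/eqP; rewrite oner_eq0.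
Qed.

Lemma qinv_out : {in [predC [pred q : quaternion R | q != 0]], @qinv R =1 id}.
Proof.
move=> q; rewrite inE /= negbK => /eqP ->; rewrite /qinv.
have -> : qmul 0 (qconj 0) = 0 * qconj 0 :> quaternion R by [].
by rewrite mul0r /qre mxE invr0 scale0r.
Qed.

HB.instance Definition _ := GRing.NzRing_hasMulInverse.Build (quaternion R)
  qmulVq qmulqV qunitP qinv_out.

Lemma qunitE q : (q \is a GRing.unit) = (q != 0).
Proof. by []. Qed.

Definition qabs q : R := Num.sqrt (qre (q * qconj q)).

Lemma qabs_sqr q : (qabs q ^+ 2)%:A = q * qconj q.
Proof. by rewrite /qabs sqr_sqrtr ?qre_mul_conj_ge0 // -qmul_conj. Qed.

End QuaternionAlgebra.

Definition imag_sphere (R : realType) : set (quaternion R) :=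
  [set q | qre q = 0 /\ qabs q = 1].

Definition slice_point (R : realType) (I : quaternion R) (z : R * R)
    : quaternion R :=
  z.1%:A + z.2 *: I.

Definition slice_restr (R : realType) (f : quaternion R -> quaternion R)
    (I : quaternion R) : R * R -> quaternion R :=
  fun z => f (slice_point I z).

(* A function U -> H is represented by a total function.  Its values outside U
   are irrelevant: since U is open, differentiability and derivatives at a point
   of U only depend on the values on U. *)
Definition left_slice_regular (R : realType) (U : set (quaternion R))
    (f : quaternion R -> quaternion R) : Prop :=
  open U /\
  forall I, imag_sphere I -> forall x y : R, U (slice_point I (x, y)) ->
    differentiable (slice_restr f I) (x, y) /\
    2^-1 *: (derive1 (fun t : R => slice_restr f I (t, y)) x
             + I * derive1 (fun t : R => slice_restr f I (x, t)) y) = 0.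

Definition right_slice_regular (R : realType) (U : set (quaternion R))
    (f : quaternion R -> quaternion R) : Prop :=
  open U /\
  forall I, imag_sphere I -> forall x y : R, U (slice_point I (x, y)) ->
    differentiable (slice_restr f I) (x, y) /\
    2^-1 *: (derive1 (fun t : R => slice_restr f I (t, y)) x
             + derive1 (fun t : R => slice_restr f I (x, t)) y * I) = 0.

Definition cauchy_denom (R : realType) (s q : quaternion R) : quaternion R :=
  q ^+ 2 - 2 * q * (qre s)%:A + (qabs s ^+ 2)%:A.

Definition cauchy_kernel (R : realType) (s q : quaternion R) : quaternion R :=
  - ((cauchy_denom s q)^-1 * (q - qconj s)).

(* Main.v *)
Require Import Defs.
From HB Require Import structures.
From mathcomp Require Import all_boot all_order all_algebra.
From mathcomp Require Import boolp classical_sets functions reals topology.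
From mathcomp Require Import normedtype derive.
From mathcomp Require Import ring.

Set Implicit Arguments.
Unset Strict Implicit.
Unset Printing Implicit Defensive.

Import GRing.Theory.
Import numFieldNormedType.Exports.
Local Open Scope classical_set_scope.
Local Open Scope ring_scope.

(** Write D(s, q) = q^2 - 2 Re(s) q + |s|^2, so that the kernel is - D^-1 N with
N = q - conj s.  In either variable it is differentiable as a function of four
real coordinates on the open set D <> 0.  By the product rule and
d(D^-1) = - D^-1 dD D^-1 its differential in a direction h is

  D^-1 (dD(h) D^-1 N - dN(h)),

and the partial derivatives of the restriction to the slice x + y I are its
values at h = 1 and h = I ([slice_partials]).  The two regularity claims are
then identities in the quaternions.

In the variable q, at a point q of the slice of I, both q and D commute with I
because the coefficients of D are real.  Hence dD(I) = I dD(1) and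
dN(I) = I = I dN(1), and I moves through D^-1 to the front: the differential at
I is I times the differential at 1, and A + I (I A) = 0.

In the variable s = x + y I, the quaternion q is arbitrary: it commutes with D
but need not commute with I.  With u = q - x one has D = u^2 + y^2, N = u + y I,
dD(1) = - 2 u and dD(I) = 2 y, and the claim reduces to u N - y N I = D
([right_cauchy_riemann_identity]). *)

Section QuaternionCalculus.
Variable R : realType.
Implicit Types (V : normedModType R) (p q s : quaternion R).

(** * Differential calculus of quaternion-valued maps *)

Lemma linear_is_diff (V W : normedModType R) (f : {linear V -> W}) (x : V) :
  continuous f -> is_diff x f f.
Proof.
by move=> fc; apply: DiffDef; [exact: linear_differentiable | exact: diff_lin].
Qed.

Lemma qreN q : qre (- q) = - qre q.
Proof. by rewrite /qre mxE. Qed.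

Lemma qimiN q : qimi (- q) = - qimi q.
Proof. by rewrite /qimi mxE. Qed.

Lemma qimjN q : qimj (- q) = - qimj q.
Proof. by rewrite /qimj mxE. Qed.

Lemma qimkN q : qimk (- q) = - qimk q.
Proof. by rewrite /qimk mxE. Qed.

Definition quat_oppE := (qreN, qimiN, qimjN, qimkN).

Lemma quat_expand (a b c d : R) : quat a b c d =
  a *: quat 1 0 0 0 + b *: quat 0 1 0 0 + c *: quat 0 0 1 0 + d *: quat 0 0 0 1.
Proof. by apply: quat_eqP; rewrite !(quat_linE, quatE); ring. Qed.

(** The topology on quaternions is that of row vectors, for which continuity is
coordinatewise. *)
Lemma continuous_quat V (a b c d : V -> R) :
  continuous a -> continuous b -> continuous c -> continuous d ->
  continuous (fun v => quat (a v) (b v) (c v) (d v)).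
Proof.
move=> ca cb cc cd x; rewrite /continuous_at quat_expand.
under eq_fun do rewrite quat_expand.
apply: cvgD; [apply: cvgD; [apply: cvgD|]|]; apply: cvgZr_tmp;
  [exact: ca | exact: cb | exact: cc | exact: cd].
Qed.

Lemma qre_continuous : continuous (@qre R).
Proof. exact: coord_continuous. Qed.

Lemma qimi_continuous : continuous (@qimi R).
Proof. exact: coord_continuous. Qed.

Lemma qimj_continuous : continuous (@qimj R).
Proof. exact: coord_continuous. Qed.

Lemma qimk_continuous : continuous (@qimk R).
Proof. exact: coord_continuous. Qed.

Lemma qre_linear : linear (@qre R : quaternion R -> R^o).
Proof. by move=> a p q; rewrite !quat_linE. Qed.
HB.instance Definition _ := GRing.isLinear.Build _ _ _ _ _ qre_linear.

Lemma qre_is_diff q : is_diff q (@qre R) (@qre R).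
Proof. exact: (linear_is_diff (f := @qre R) _ qre_continuous). Qed.

Lemma qconj_linear : linear (@qconj R).
Proof.
by move=> a p q; apply: quat_eqP; rewrite /qconj !(quat_linE, quatE); ring.
Qed.
HB.instance Definition _ := GRing.isLinear.Build _ _ _ _ _ qconj_linear.

Lemma qconj_continuous : continuous (@qconj R).
Proof.
apply: continuous_quat; first exact: qre_continuous.
- by move=> q; apply: continuousN; exact: qimi_continuous.
- by move=> q; apply: continuousN; exact: qimj_continuous.
- by move=> q; apply: continuousN; exact: qimk_continuous.
Qed.

Lemma qconj_is_diff q : is_diff q (@qconj R) (@qconj R).
Proof. exact: linear_is_diff qconj_continuous. Qed.

Lemma qmul_continuous :
  continuous (fun p : quaternion R * quaternion R => p.1 * p.2).
Proof.
have c (g h : quaternion R -> R) : continuous g -> continuous h ->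
    continuous (fun w : quaternion R * quaternion R => g w.1 * h w.2).
  move=> gc hc z; apply: (@continuousM _ _ (g \o fst) (h \o snd)).
    by apply: continuous_comp; [exact: cvg_fst | exact: gc].
  by apply: continuous_comp; [exact: cvg_snd | exact: hc].
have [c0 c1 c2 c3] := And4 qre_continuous qimi_continuous qimj_continuous
  qimk_continuous.
have add (g h : quaternion R * quaternion R -> R) :
    continuous g -> continuous h -> continuous (fun w => g w + h w).
  by move=> gc hc z; apply: continuousD; [exact: gc | exact: hc].
have sub (g h : quaternion R * quaternion R -> R) :
    continuous g -> continuous h -> continuous (fun w => g w - h w).
  by move=> gc hc z; apply: continuousB; [exact: gc | exact: hc].
apply: continuous_quat.
- exact: sub (sub _ _ (sub _ _ (c _ _ c0 c0) (c _ _ c1 c1)) (c _ _ c2 c2))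
    (c _ _ c3 c3).
- exact: sub (add _ _ (add _ _ (c _ _ c0 c1) (c _ _ c1 c0)) (c _ _ c2 c3))
    (c _ _ c3 c2).
- exact: add (add _ _ (sub _ _ (c _ _ c0 c2) (c _ _ c1 c3)) (c _ _ c2 c0))
    (c _ _ c3 c1).
- exact: add (sub _ _ (add _ _ (c _ _ c0 c3) (c _ _ c1 c2)) (c _ _ c2 c1))
    (c _ _ c3 c0).
Qed.

(** Stated for the underlying function [qmul], since the product of a ring is
already the key of the bilinear structure on real multiplication. *)
Lemma qmul_is_bilinear : bilinear_for
    (GRing.Scale.Law.clone _ _ *:%R _) (GRing.Scale.Law.clone _ _ *:%R _)
    (@qmul R).
Proof.
split=> [u'|u] a x y /=.
- by rewrite qmulDl qscaleAl.
- by rewrite qmulDr qscaleAr.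
Qed.
HB.instance Definition _ := bilinear_isBilinear.Build R
  (quaternion R) (quaternion R) (quaternion R) _ _ (@qmul R) qmul_is_bilinear.

Lemma is_diff_qmul V (f g df dg : V -> quaternion R) (x : V) :
  is_diff x f df -> is_diff x g dg ->
  is_diff x (fun v => f v * g v) (fun h => f x * dg h + df h * g x).
Proof.
move=> dfx dgx.
have dmul (z : quaternion R * quaternion R) : is_diff z (fun w => w.1 * w.2)
    (fun w => z.1 * w.2 + w.1 * z.2).
  apply: DiffDef; first exact: differentiable_bilin qmul_continuous.
  exact: (diff_bilin (f := @qmul R) z qmul_continuous).
exact: (is_diff_comp (is_diff_pair dfx dgx) (dmul (f x, g x))).
Qed.

Lemma is_diff_real V (k dk : V -> R) (x : V) :
  is_diff x k dk -> is_diff x (fun v => (k v)%:A : quaternion R) (fun h => (dk h)%:A).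
Proof.
move=> [k_diff <-]; apply: DiffDef; first exact: differentiableZl.
by rewrite diffZl.
Qed.

Lemma qinvE q : q^-1 = (qre (q * qconj q))^-1%:A * qconj q.
Proof. by rewrite -scalerAl mul1r. Qed.

(** The inverse is conj q divided by the real number q (conj q), which is a
nonvanishing polynomial in the coordinates. *)
Lemma differentiable_qinv q : q != 0 -> differentiable (@GRing.inv (quaternion R)) q.
Proof.
move=> q0; rewrite (funext qinvE).
have dN := is_diff_comp (is_diff_qmul (is_diff_id q) (qconj_is_diff q)) (qre_is_diff _).
have N0 : qre (q * qconj q) != 0 by rewrite qre_mul_conj_eq0.
have dNV := differentiableP (differentiableV (@ex_diff _ _ _ _ _ _ _ dN) N0).
exact: @ex_diff _ _ _ _ _ _ _ (is_diff_qmul (is_diff_real dNV) (qconj_is_diff q)).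
Qed.

(** Once the inverse is known to be differentiable, its differential dV(h) is
forced by differentiating p p^-1 p = p at q: this gives
h + (q dV(h) + h q^-1) q = h.  Unlike p p^-1 = 1, this identity also holds at
p = 0, so that it is an equality of functions and not only a local one. *)
Lemma is_diff_qinv q : q != 0 ->
  is_diff q (@GRing.inv (quaternion R)) (fun h => - (q^-1 * h * q^-1)).
Proof.
move=> q0; have /differentiableP dV := differentiable_qinv q0.
apply: is_diff_eq (dV) _; apply/funext => h; set dVh := 'd _ _ h.
have qVq : (fun p => p * p^-1 * p) = @idfun (quaternion R).
  apply/funext => p; have [->|p0] := eqVneq p 0; first by rewrite mulr0.
  by rewrite divrr ?mul1r.
have dT := is_diff_qmul (is_diff_qmul (is_diff_id q) dV) (is_diff_id q).
have uq : q \is a GRing.unit by [].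
rewrite qVq in dT.
have := etrans (esym (@diff_val _ _ _ _ _ _ _ dT))
  (@diff_val _ _ _ _ _ _ _ (is_diff_id q)).
move=> /(congr1 (@^~ h)) /=; rewrite -/dVh divrr // mul1r mulrDl (divrK uq).
rewrite addrA -[RHS]add0r => /addIr/eqP; rewrite addrC addr_eq0 => /eqP qdVq.
by rewrite -(opprK h) -qdVq mulrN mulNr opprK -!mulrA divrr // mulr1 mulKr.
Qed.

Lemma is_diff_continuous V (f df : V -> quaternion R) (x : V) :
  is_diff x f df -> {for x, continuous f}.
Proof. by move=> df_x; apply: differentiable_continuous; exact: ex_diff. Qed.

Lemma open_neq0 (f : quaternion R -> quaternion R) :
  continuous f -> open [set q | f q <> 0].
Proof.
move=> fc; apply: (@open_comp _ _ f (~` [set 0])) => [q _|]; first exact: fc.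
by apply: closed_openC; apply: accessible_closed_set1; apply: hausdorff_accessible.
Qed.

Lemma is_diff_opp_invM V (f g df dg : V -> quaternion R) (x : V) : f x <> 0 ->
  is_diff x f df -> is_diff x g dg ->
  is_diff x (fun v => - ((f v)^-1 * g v))
    (fun h => (f x)^-1 * (df h * ((f x)^-1 * g x) - dg h)).
Proof.
move=> /eqP fx0 dfx dgx.
have := is_diffN (is_diff_qmul (is_diff_comp dfx (is_diff_qinv fx0)) dgx).
move=> /is_diff_eq; apply; apply/funext => h.
rewrite -[LHS]/(- ((f x)^-1 * dg h + - ((f x)^-1 * df h * (f x)^-1) * g x)).
by rewrite mulNr opprD opprK addrC mulrBr !mulrA.
Qed.

(** * Restriction to a slice *)

Lemma slice_point_linear (I : quaternion R) : linear (slice_point I).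
Proof.
move=> a z w; rewrite /slice_point /= scalerDr !scalerDl !scalerA addrACA.
by rewrite /GRing.scale /=.
Qed.
HB.instance Definition _ (I : quaternion R) :=
  GRing.isLinear.Build _ _ _ _ _ (slice_point_linear I).

Lemma slice_point_continuous (I : quaternion R) : continuous (slice_point I).
Proof.
by move=> z; apply: cvgD; apply: cvgZr_tmp; [exact: cvg_fst | exact: cvg_snd].
Qed.

Lemma slice_restr_is_diff (I : quaternion R) (f df : quaternion R -> quaternion R)
    (z : R * R) :
  is_diff (slice_point I z) f df ->
  is_diff z (slice_restr f I) (df \o slice_point I).
Proof.
move=> dfz; have dI := linear_is_diff z (@slice_point_continuous I).
exact: is_diff_comp dI dfz.
Qed.

Lemma partial_derive1 (F dF : R * R -> quaternion R) (x y : R) :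
  is_diff (x, y) F dF ->
  derive1 (fun t => F (t, y)) x = dF (1, 0) /\
  derive1 (fun t => F (x, t)) y = dF (0, 1).
Proof.
move=> dFz.
have d1 : is_diff x (fun t => F (t, y)) (fun h => dF (h, 0)).
  exact: (is_diff_comp (is_diff_pair (is_diff_id x) (is_diff_cst y x)) dFz).
have d2 : is_diff y (fun t => F (x, t)) (fun h => dF (0, h)).
  exact: (is_diff_comp (is_diff_pair (is_diff_cst x y) (is_diff_id y)) dFz).
have derive1_diff (f df : R -> quaternion R) (t : R) :
    is_diff t f df -> derive1 f t = df 1.
  by move=> [fd fe]; rewrite derive1E' // fe.
by split; [exact: derive1_diff d1 | exact: derive1_diff d2].
Qed.

Lemma slice_partials (I : quaternion R) (f df : quaternion R -> quaternion R) (x y : R) :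
  is_diff (slice_point I (x, y)) f df ->
  [/\ differentiable (slice_restr f I) (x, y),
    derive1 (fun t => slice_restr f I (t, y)) x = df 1 &
    derive1 (fun t => slice_restr f I (x, t)) y = df I].
Proof.
move=> /slice_restr_is_diff dF; have [-> ->] := partial_derive1 dF.
by split; [exact: ex_diff | |]; rewrite /= /slice_point /=
  ?scale1r ?scale0r ?addr0 ?add0r.
Qed.

Lemma imag_sphere_conj (I : quaternion R) : imag_sphere I -> qconj I = - I.
Proof.
by case=> I0 _; apply: quat_eqP; rewrite /qconj !(quatE, quat_oppE) // I0 oppr0.
Qed.

Lemma imag_sphere_sqr (I : quaternion R) : imag_sphere I -> I * I = - 1.
Proof.
move=> IS; have := qabs_sqr I; rewrite (imag_sphere_conj IS).
by case: IS => _ ->; rewrite expr1n scale1r mulrN => ->; rewrite opprK.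
Qed.

Lemma slice_point_comm (I : quaternion R) (z : R * R) :
  GRing.comm I (slice_point I z).
Proof.
by rewrite /GRing.comm mulrDr mulrDl -!scalerAr -!scalerAl mulr1 mul1r.
Qed.

(** * The Cauchy kernel *)

Lemma cauchy_denomE s q :
  cauchy_denom s q = q * q - (2 * qre s) *: q + s * qconj s.
Proof.
rewrite /cauchy_denom qabs_sqr expr2 -scalerAr mulr1.
by rewrite mulr_natl [in RHS]mulrC -scalerA scaler_nat.
Qed.

Lemma cauchy_denom_is_diff_right s q : is_diff q (cauchy_denom s)
  (fun h => q * h + h * q - (2 * qre s) *: h).
Proof.
rewrite (funext (cauchy_denomE s)).
have dq := is_diff_id q.
have := is_diffD (is_diffB (is_diff_qmul dq dq) (is_diffZ (2 * qre s) dq))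
  (is_diff_cst (s * qconj s) q).
by move=> /is_diff_eq; apply; apply/funext => h; exact: addr0.
Qed.

Lemma cauchy_denom_is_diff_left s q : is_diff s (fun v => cauchy_denom v q)
  (fun h => - ((2 * qre h) *: q) + (s * qconj h + h * qconj s)).
Proof.
rewrite (funext (fun v => cauchy_denomE v q)).
have dre : is_diff s (fun v => (2 * qre v) *: q) (fun h => (2 * qre h) *: q).
  have [d2 e2] := is_diffZ 2 (qre_is_diff s).
  apply: DiffDef; first exact: (differentiableZl q d2).
  by rewrite (diffZl q d2) e2.
have := is_diffD (is_diffB (is_diff_cst (q * q) s) dre)
  (is_diff_qmul (is_diff_id s) (qconj_is_diff s)).
by move=> /is_diff_eq; apply; apply/funext => h; congr (_ + _); exact: add0r.
Qed.

(** The numerator q - conj s need not commute with I, but it stays on the right;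
the point of the slice and the denominator do commute with I, so the
differential at I is I times the differential at 1. *)
Lemma cauchy_kernel_left_regular s :
  left_slice_regular [set q | cauchy_denom s q <> 0] (cauchy_kernel s).
Proof.
split.
  apply: open_neq0 => q.
  exact: is_diff_continuous (cauchy_denom_is_diff_right s q).
move=> I IS x y; set w := slice_point I (x, y) => Dw0.
have dN : is_diff w (fun q => q - qconj s) id.
  have := is_diffB (is_diff_id w) (is_diff_cst (qconj s) w).
  by move=> /is_diff_eq; apply; apply/funext => h; exact: subr0.
have dK := is_diff_opp_invM Dw0 (cauchy_denom_is_diff_right s w) dN.
have [Kd -> ->] := slice_partials dK; split=> //.
have wI : w * I = I * w by exact/esym/slice_point_comm.
(* All that matters of the point from here on is that it commutes with I; with
   its body visible, rewriting would distribute products over it. *)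
clearbody w.
set D := cauchy_denom s w; set c := 2 * qre s.
have DI : D^-1 * I = I * D^-1.
  apply/esym/commrV; rewrite /D cauchy_denomE -/c qmul_conj.
  apply: commrD; first apply: commrB.
  - by apply: commrM; exact: esym wI.
  - by rewrite /GRing.comm -scalerAr -scalerAl wI.
  - by rewrite /GRing.comm -scalerAr -scalerAl mulr1 mul1r.
have -> : w * I + I * w - c *: I = I * (w * 1 + 1 * w - c *: 1).
  by rewrite mulrBr mulrDr mulr1 mul1r -scalerAr mulr1 wI.
have factorI e Y : D^-1 * (I * e * Y - I) = I * (D^-1 * (e * Y - 1)).
  by rewrite -[I * e * Y]mulrA -{2}[I]mulr1 -mulrBr mulrA DI -mulrA.
rewrite factorI [I * (I * _)]mulrA (imag_sphere_sqr IS) mulN1r subrr.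
by rewrite scaler0.
Qed.

(** With u = q - x, N = u + y I is the numerator q - conj s at s = x + y I and
u * u + y^2 is the denominator; - 2 u, 2 y, -1 and I are the derivatives of the
denominator and of the numerator in x and y.  What makes the two terms cancel
is u N - y N I = u^2 + y^2, where the mixed terms disappear without u and I
having to commute. *)
Lemma right_cauchy_riemann_identity (u I : quaternion R) (y : R) :
  let D := u * u + (y ^+ 2)%:A in let N := u + y *: I in
  I * I = - 1 -> D \is a GRing.unit ->
  D^-1 * (- (u + u) * (D^-1 * N) + 1) +
  D^-1 * ((2 * y)%:A * (D^-1 * N) - I) * I = 0.
Proof.
move=> D N II D_unit.
have uD : u * D^-1 = D^-1 * u.
  apply: commrV; apply: commrD; first exact: commrM.
  by rewrite /GRing.comm -scalerAr -scalerAl mulr1 mul1r.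
have NI : u * N - y *: (N * I) = D.
  rewrite /D /N mulrDr mulrDl scalerDr -!scalerAr -!scalerAl II opprD addrA addrK.
  by rewrite !scalerN opprK scalerA expr2.
(* The body of quaternion inversion is a scaling, which the rewriting of
   scalings below would otherwise match. *)
have VD := mulVr D_unit.
set V := D^-1 in uD VD *; clearbody V D N.
rewrite -[_ * _ * I]mulrA -mulrDr.
have -> : - (u + u) * (V * N) + 1 + ((2 * y)%:A * (V * N) - I) * I
    = - (V * ((u * N - y *: (N * I)) *+ 2)) + 1 *+ 2.
  have uVN : - (u + u) * (V * N) = - ((V * (u * N)) *+ 2).
    by rewrite -mulr2n mulNr mulrnAl mulrA uD -mulrA.
  have yVNI : (2 * y)%:A * (V * N) * I = (V * (y *: (N * I))) *+ 2.
    by rewrite mulr_algl -scalerAl -scalerAr -mulrA mulr_natl -scalerMnl.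
  rewrite mulrBl II opprK addrACA uVN yVNI.
  by rewrite mulrnAr mulrBr mulrnBl opprB addrC [- _ + _]addrC [LHS]addrC.
by rewrite NI mulrnAr VD addNr mulr0.
Qed.

(** The denominator is differentiated as a function of the whole quaternion s,
with |s|^2 = s (conj s); restricting to s = x + y I then brings the two partial
derivatives to the form of [right_cauchy_riemann_identity]. *)
Lemma cauchy_kernel_right_regular q :
  right_slice_regular [set s | cauchy_denom s q <> 0] (fun s => cauchy_kernel s q).
Proof.
split.
  apply: open_neq0 => s.
  exact: is_diff_continuous (cauchy_denom_is_diff_left s q).
move=> I IS x y; set w := slice_point I (x, y) => Dw0.
have dN : is_diff w (fun s => q - qconj s) (fun h => - qconj h).
  have := is_diffB (is_diff_cst q w) (qconj_is_diff w).
  by move=> /is_diff_eq; apply; apply/funext => h; exact: add0r.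
have dK := is_diff_opp_invM (f := fun v => cauchy_denom v q) Dw0
  (cauchy_denom_is_diff_left w q) dN.
have [Kd -> ->] := slice_partials dK; split=> //.
set u := q - x%:A.
have conj1 : qconj 1 = 1 :> quaternion R.
  by apply: quat_eqP; rewrite /GRing.one /= /qconj !quatE ?oppr0.
have re1 : qre (1 : quaternion R) = 1 by rewrite /GRing.one /= quatE.
have reI : qre I = 0 by case: IS.
have conjI := imag_sphere_conj IS.
have conjw : qconj w = x%:A - y *: I.
  by rewrite linearD !linearZ /= conj1 conjI scalerN.
have rew : qre w = x by rewrite !quat_linE re1 reI mulr1 mulr0 addr0.
have II := imag_sphere_sqr IS.
have ww : w * qconj w = (x ^+ 2 + y ^+ 2)%:A.
  rewrite conjw /w /slice_point /= mulrBr !mulrDl -!scalerAr -!scalerAl !mul1r.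
  rewrite !mulr1 II !scalerN !scalerA [y * x]mulrC opprD opprK.
  by rewrite addrA addrK -scalerDl.
have conjwE : w + qconj w = (2 * x)%:A.
  by rewrite conjw /w /slice_point /= addrACA subrr addr0 -scalerDl mulr_natl.
have dD1 : - (2 *: q) + (w + qconj w) = - (u + u).
  rewrite conjwE /u mulr_natl scaler_nat mulr2n scalerDl opprD addrACA.
  by rewrite ![- q + _]addrC -opprB -opprD.
have dDI : w * - I + I * qconj w = (2 * y)%:A.
  rewrite conjw /w /slice_point /= mulrN mulrDl mulrBr -!scalerAr -!scalerAl.
  rewrite mul1r mulr1 II !scalerN opprB opprK.
  by rewrite addrA subrK -scalerDl mulr_natl.
clearbody w.
have DE : cauchy_denom w q = u * u + (y ^+ 2)%:A.
  rewrite cauchy_denomE ww rew /u mulrBr !mulrBl -!scalerAr -!scalerAl mul1r !mulr1.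
  rewrite mulr_natl mulr2n scalerA !scalerDl opprB opprD expr2 -!addrA.
  by congr (_ + (_ + _)); rewrite addrCA.
have D_unit : u * u + (y ^+ 2)%:A \is a GRing.unit by rewrite -DE; apply/eqP.
have NE : q - qconj w = u + y *: I by rewrite conjw opprB addrA addrAC.
rewrite NE !opprK conj1 conjI re1 reI mulr0 scale0r oppr0 add0r !mulr1 mul1r.
by rewrite dD1 dDI DE (right_cauchy_riemann_identity II D_unit) scaler0.
Qed.

End QuaternionCalculus.

Theorem proposition2p17 (R : realType) :
  (forall s : quaternion R,
     left_slice_regular [set q : quaternion R | cauchy_denom s q <> 0]
       (fun q => cauchy_kernel s q)) /\
  (forall q : quaternion R,
     right_slice_regular [set s : quaternion R | cauchy_denom s q <> 0]
       (fun s => cauchy_kernel s q)).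
Proof.
split; [exact: cauchy_kernel_left_regular | exact: cauchy_kernel_right_regular].
Qed.
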